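(* Let $k$ be a positive integer. Let $\mathfrak{M}$ be a $\Gamma$-ring containing a family $\{e_\alpha \mid \alpha\in\Lambda\}$, where each $e_\alpha$ is a $\gamma_\alpha$-idempotent (for some $\gamma_\alpha\in\Gamma$), which satisfies: (i) For each $\alpha\in\Lambda$ there are two $\mathfrak{M}$-additive maps $f_\alpha:\Gamma\times\mathfrak{M}\to\mathfrak{M}$ and $f'_\alpha:\mathfrak{M}\times\Gamma\to\mathfrak{M}$ satisfying $f_\alpha(\gamma_\alpha,a)=a-e_\alpha\gamma_\alpha a$ and $f'_\alpha(a,\gamma_\alpha)=a-a\gamma_\alpha e_\alpha$ for all $a\in\mathfrak{M}$, such that, denoting $f_\alpha\beta a=f_\alpha(\beta,a)$, $a\beta f_\alpha=f'_\alpha(a,\beta)$, $1_\alpha\beta a=e_\alpha\beta a+f_\alpha\beta a$, $a\beta 1_\alpha=a\beta e_\alpha+a\beta f_\alpha$ (so that formally $1_\alpha=e_\alpha+f_\alpha$), one has $(a\beta f_\alpha)\gamma b=a\beta(f_\alpha\gamma b)$ for all $a,b\in\mathfrak{M}$ and $\beta,\gamma\in\Gamma$. (ii) If $x\in\mathfrak{M}$ is such that $x\Gamma\mathfrak{M}=0$, then $x=0$. (iii) If $x\in\mathfrak{M}$ is such that $e_\alpha\Gamma\mathfrak{M}\Gamma x=0$ for all $\alpha\in\Lambda$, then $x=0$ (and hence $\mathfrak{M}\Gamma x=0$ implies $x=0$). (iv) For each $\alpha\in\Lambda$ and $x\in\mathfrak{M}$, if $(e_\alpha\gamma_\alpha x\gamma_\alpha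 e_\alpha)\Gamma\mathfrak{M}\Gamma(1_\alpha-e_\alpha)=0$, then $e_\alpha\gamma_\alpha x\gamma_\alpha e_\alpha=0$. Suppose that $f:\mathfrak{M}\times\Gamma\times\mathfrak{M}\to\mathfrak{M}$ is a mapping such that: (v) $f(x,\gamma,0)=f(0,\gamma,x)=0$ for all $x\in\mathfrak{M}$ and $\gamma\in\Gamma$; (vi) $u_1\gamma_1u_2\cdots\gamma_{k-1}u_k\gamma_k f(x,\gamma,y)=f(u_1\gamma_1u_2\cdots\gamma_{k-1}u_k\gamma_k x,\ \gamma,\ u_1\gamma_1u_2\cdots\gamma_{k-1}u_k\gamma_k y)$; (vii) $f(x,\gamma,y)\gamma_1u_1\gamma_2u_2\cdots\gamma_k u_k=f(x\gamma_1u_1\gamma_2u_2\cdots\gamma_k u_k,\ \gamma,\ y\gamma_1u_1\gamma_2u_2\cdots\gamma_k u_k)$; where (vi) and (vii) hold for all $x,y,u_1,\dots,u_k\in\mathfrak{M}$ and $\gamma,\gamma_1,\dots,\gamma_k\in\Gamma$. Then $f=0$.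
   Context: Let $\mathfrak{M}$ and $\Gamma$ be two (additively written) abelian groups. $\mathfrak{M}$ is called a $\Gamma$-ring (in the sense of Barnes) if there is a product $(x,\alpha,y)\mapsto x\alpha y$ on $\mathfrak{M}\times\Gamma\times\mathfrak{M}$ such that for all $x,y,z\in\mathfrak{M}$, $\alpha,\beta\in\Gamma$: $x\alpha y\in\mathfrak{M}$; $(x+y)\alpha z=x\alpha z+y\alpha z$ and $x\alpha(y+z)=x\alpha y+x\alpha z$; $x(\alpha+\beta)y=x\alpha y+x\beta y$; $(x\alpha y)\beta z=x\alpha(y\beta z)$. Longer products are thus written without parentheses. For $\gamma\in\Gamma$, a $\gamma$-idempotent is a nonzero element $e\in\mathfrak{M}$ with $e\gamma e=e$. A map $\Gamma\times\mathfrak{M}\to\mathfrak{M}$ or $\mathfrak{M}\times\Gamma\to\mathfrak{M}$ is $\mathfrak{M}$-additive if it is additive in its $\mathfrak{M}$-variable (for each fixed element of $\Gamma$). For subsets $\mathfrak{A},\mathfrak{B}\subseteq\mathfrak{M}$ and $\Theta\subseteq\Gamma$, $\mathfrak{A}\Theta\mathfrak{B}$ denotes the set of all finite sums $\sum_i a_i\gamma_i b_i$ with $a_i\in\mathfrak{A}$, $\gamma_i\in\Theta$, $b_i\in\mathfrak{B}$; a single element stands for the corresponding singleton. The symbol $1_\alpha-e_\alpha$ stands for $f_\alpha$, so $(e_\alpha\gamma_\alpha x\gamma_\alpha e_\alpha)\Gamma\mathfrak{M}\Gamma(1_\alpha-e_\alpha)=0$ means $f'_\alpha\big((e_\alpha\gamma_\alpha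 x\gamma_\alpha e_\alpha)\beta m,\gamma\big)=0$ for all $m\in\mathfrak{M}$, $\beta,\gamma\in\Gamma$. *)

(* Defs.v *)
From HB Require Import structures.
From mathcomp Require Import all_boot all_order all_algebra.
From mathcomp Require Import classical_sets.

Set Implicit Arguments.
Unset Strict Implicit.
Unset Printing Implicit Defensive.

Import GRing.Theory.
Local Open Scope classical_set_scope.
Local Open Scope ring_scope.

(* Gamma-rings in the sense of Barnes; [R x a y] is the product x a y. *)
Record gammaRing (M G : zmodType) := GammaRing {
  gmul :> M -> G -> M -> M;
  gmulDl : forall x y a z, gmul (x + y) a z = gmul x a z + gmul y a z;
  gmulDr : forall x a y z, gmul x a (y + z) = gmul x a y + gmul x a z;
  gmulDm : forall x a b y, gmul x (a + b) y = gmul x a y + gmul x b y;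
  gmulA : forall x a y b z, gmul (gmul x a y) b z = gmul x a (gmul y b z)
}.

Definition gidempotent (M G : zmodType) (R : gammaRing M G) (g : G) (e : M) :
    Prop :=
  e <> 0 /\ R e g e = e.

(* All finite sums of products a g b with a in A, g in T, b in B. *)
Definition gset_mul (M G : zmodType) (R : gammaRing M G)
    (A : set M) (T : set G) (B : set M) : set M :=
  [set z | exists2 s : seq (M * G * M),
     forall t, t \in s -> [/\ A t.1.1, T t.1.2 & B t.2] &
     z = \sum_(t <- s) R t.1.1 t.1.2 t.2].

(* [fl b a] and [fr a b] play the roles of f b a and a b f, where f is the
   formal complement 1 - e, which need not exist in M. *)
Definition formal_complement (M G : zmodType) (R : gammaRing M G)
    (g : G) (e : M) (fl : G -> M -> M) (fr : M -> G -> M) : Prop :=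
  [/\ forall b, {morph fl b : x y / x + y},
      forall b, {morph fr^~ b : x y / x + y},
      forall a, fl g a = a - R e g a,
      forall a, fr a g = a - R a g e &
      forall a b c d, R (fr a b) c d = R a b (fl c d)].

(* u_1 g_1 u_2 g_2 ... u_k g_k x  for  s = [:: (u_1, g_1); ...; (u_k, g_k)] *)
Definition lword (M G : zmodType) (R : gammaRing M G)
    (s : seq (M * G)) (x : M) : M :=
  foldr (fun p z => R p.1 p.2 z) x s.

(* x g_1 u_1 g_2 u_2 ... g_k u_k  for  s = [:: (g_1, u_1); ...; (g_k, u_k)] *)
Definition rword (M G : zmodType) (R : gammaRing M G)
    (x : M) (s : seq (G * M)) : M :=
  foldl (fun z p => R z p.1 p.2) x s.

(* Main.v *)
(* An application of faithfulness ((ii), (iii)) reduces the k-fold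
   compatibilities (vi), (vii) to the case k = 1, and shows that F := f _ c _
   commutes with every operator T that becomes a right multiplication once
   followed by a right multiplication.  Among these are a |-> a b (1 - e) and,
   for fixed y, a |-> a g (y + (1 - e)).  The latter sends e to y and fixes x
   whenever x, y lie in the Peirce component e M (1 - e), so that
   F(y, x) = T (F(e, x)) = 0, because F(e, x) has no component on either side of
   e.  Condition (iv) carries this over to e M e, so e g F(x, y) = 0 for all
   x and y, and (iii) concludes. *)

Require Import Defs.
From HB Require Import structures.
From mathcomp Require Import all_boot all_order all_algebra.
From mathcomp Require Import classical_sets.

Set Implicit Arguments.
Unset Strict Implicit.
Unset Printing Implicit Defensive.

Import GRing.Theory.
Local Open Scope classical_set_scope.
Local Open Scope ring_scope.

Section GammaRing.

Context {M G : zmodType} (R : gammaRing M G).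

Lemma gmul0l a x : R 0 a x = 0.
Proof. by apply: (addrI (R 0 a x)); rewrite -gmulDl !addr0. Qed.

Lemma gmul0r x a : R x a 0 = 0.
Proof. by apply: (addrI (R x a 0)); rewrite -gmulDr !addr0. Qed.

Lemma gmulBl x y a z : R (x - y) a z = R x a z - R y a z.
Proof. by apply/eqP; rewrite eq_sym subr_eq -gmulDl subrK. Qed.

Lemma gmulBr x a y z : R x a (y - z) = R x a y - R x a z.
Proof. by apply/eqP; rewrite eq_sym subr_eq -gmulDr subrK. Qed.

Lemma gset_mul_eq0 (A : set M) (T : set G) (B : set M) :
  (forall a t b, A a -> T t -> B b -> R a t b = 0) ->
  gset_mul R A T B = [set 0].
Proof.
move=> H; apply/seteqP; split=> z /=.
  move=> [s sP ->]; rewrite big_seq big1 // => p /sP [? ? ?]; exact: H.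
by move=> ->; exists [::]; rewrite ?big_nil.
Qed.

Lemma lwordB s x y : lword R s (x - y) = lword R s x - lword R s y.
Proof. by elim: s => //= p s ->; rewrite gmulBr. Qed.

Lemma rwordB s x y : rword R (x - y) s = rword R x s - rword R y s.
Proof. by elim: s x y => //= p s IH x y; rewrite gmulBl IH. Qed.

Lemma lword_rcons s p x : lword R (rcons s p) x = lword R s (R p.1 p.2 x).
Proof. by rewrite /lword foldr_rcons. Qed.

Section RightFaithful.

Hypothesis rfaithful : forall x, (forall b m, R x b m = 0) -> x = 0.

Lemma rword_eq0 k z : (forall s : k.-tuple (G * M), rword R z s = 0) -> z = 0.
Proof.
elim: k z => [|k IH] z H; first exact: (H [tuple]).
apply: rfaithful => b m; apply: IH => s; exact: (H (cons_tuple (b, m) s)).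
Qed.

(** Both sides are tested against one more word of length [k]. As [k] is positive, this word has a
    first letter [p], which merges with the factor [b u] into the single letter [(b, R u p.1 p.2)];
    the total length is again [k]. *)
Lemma rword_compat1 k (F : M -> M -> M) : (0 < k)%N ->
  (forall (s : k.-tuple (G * M)) x y,
     rword R (F x y) s = F (rword R x s) (rword R y s)) ->
  forall x y b u, R (F x y) b u = F (R x b u) (R y b u).
Proof.
case: k => // k _ hF x y b u.
apply/eqP; rewrite -subr_eq0; apply/eqP/(@rword_eq0 k.+1) => s.
rewrite rwordB hF; apply/eqP; rewrite subr_eq0; apply/eqP.
case/tupleP: s => p s.
have E z : rword R (R z b u) (cons_tuple p s)
         = rword R z (cons_tuple (b, R u p.1 p.2) s) by rewrite /= gmulA.
by rewrite !E hF.
Qed.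

(** After a factor [b m], [T] becomes right multiplication by the genuine element [w b m], which
    passes through [F]; faithfulness then removes [b m]. *)
Lemma right_multiplier_compat (F : M -> M -> M)
    (hF : forall x y b u, R (F x y) b u = F (R x b u) (R y b u))
    (T : M -> M) (c : G) (w : G -> M -> M)
    (hT : forall x b m, R (T x) b m = R x c (w b m)) x y :
  T (F x y) = F (T x) (T y).
Proof.
apply/eqP; rewrite -subr_eq0; apply/eqP/rfaithful => b m.
by rewrite gmulBl hT !hF !hT subrr.
Qed.

End RightFaithful.

Section LeftFaithful.

Hypothesis lfaithful : forall x, (forall m b, R m b x = 0) -> x = 0.

Lemma lword_eq0 k z : (forall s : k.-tuple (M * G), lword R s z = 0) -> z = 0.
Proof.
elim: k z => [|k IH] z H; first exact: (H [tuple]).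
apply: lfaithful => m b; apply: IH => s.
by have := H (rcons_tuple s (m, b)); rewrite lword_rcons.
Qed.

Lemma lword_compat1 k (F : M -> M -> M) : (0 < k)%N ->
  (forall (s : k.-tuple (M * G)) x y,
     lword R s (F x y) = F (lword R s x) (lword R s y)) ->
  forall x y u b, R u b (F x y) = F (R u b x) (R u b y).
Proof.
case: k => // k _ hF x y u b.
apply/eqP; rewrite -subr_eq0; apply/eqP/(@lword_eq0 k.+1) => s.
rewrite lwordB hF; apply/eqP; rewrite subr_eq0; apply/eqP.
(* The letter adjacent to [u] is the last one of [s], so [s] is split at its end. *)
have [p [s' Es]] : exists p, exists s' : k.-tuple (M * G), s = rcons_tuple s' p.
  have sz : size (belast (thead s) (behead s)) == k.
    by rewrite size_belast size_behead size_tuple.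
  exists (last (thead s) (behead s)), (Tuple sz).
  by apply/val_inj; rewrite /= -lastI [in LHS](tuple_eta s).
have E z : lword R s (R u b z) = lword R (rcons_tuple s' (R p.1 p.2 u, b)) z.
  by rewrite Es !lword_rcons /= gmulA.
by rewrite !E hF.
Qed.

End LeftFaithful.

Section Peirce.

Hypothesis rfaithful : forall x, (forall b m, R x b m = 0) -> x = 0.
Context (F : M -> M -> M).
Hypothesis F0r : forall x, F x 0 = 0.
Hypothesis F0l : forall x, F 0 x = 0.
Hypothesis hFl : forall x y u b, R u b (F x y) = F (R u b x) (R u b y).
Hypothesis hFr : forall x y b u, R (F x y) b u = F (R x b u) (R y b u).
Context (g : G) (e : M) (fl : G -> M -> M) (fr : M -> G -> M).
Hypothesis egee : R e g e = e.
Hypothesis compl : formal_complement R g e fl fr.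

Let flg a : fl g a = a - R e g a. Proof. by case: compl. Qed.
Let frg a : fr a g = a - R a g e. Proof. by case: compl. Qed.
Let frA a b c d : R (fr a b) c d = R a b (fl c d). Proof. by case: compl. Qed.

Lemma fr_compat x y b : fr (F x y) b = F (fr x b) (fr y b).
Proof.
exact: (right_multiplier_compat rfaithful hFr (T := fr^~ b) (w := fl)).
Qed.

Lemma fr_mul_idem a b : R (fr a b) g e = 0.
Proof. by rewrite frA flg egee subrr gmul0r. Qed.

Lemma F_peirce12 x y : R e g x = x -> R x g e = 0 -> R e g y = y ->
  F y x = 0.
Proof.
move=> ex xe ey.
have fre : fr e g = 0 by rewrite frg egee subrr.
have Fex : F e x = 0.
  (* The e-component of F(e, x) is F(e g e, x g e) with x g e = 0; the complementary one has first
     argument e g (1 - e) = 0. *)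
  have A : R (F e x) g e = 0 by rewrite hFr xe F0r.
  have : fr (F e x) g = 0 by rewrite fr_compat fre F0l.
  by rewrite frg A subr0.
pose T a := R a g y + fr a g.
have TF : T (F e x) = F (T e) (T x).
  apply: (right_multiplier_compat rfaithful hFr (c := g)
            (w := fun b m => R y b m + fl b m)) => a b m.
  by rewrite gmulDl gmulDr frA gmulA.
have Te : T e = y by rewrite /T ey fre addr0.
(* Here x g y = (x g e) g y = 0, because y = e g y. *)
have Tx : T x = x by rewrite /T -{1}ey -gmulA xe gmul0l add0r frg xe subr0.
by rewrite Te Tx in TF; rewrite -TF Fex /T gmul0l frg gmul0l subr0 addr0.
Qed.

Lemma F_corner x y :
  (forall z, (forall b m c, fr (R (R (R e g z) g e) b m) c = 0) ->
     R (R e g z) g e = 0) ->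
  R e g (F x y) = 0.
Proof.
(* The complement axiom rebrackets only in front of a right factor, so the identity e g (a b (1 -
   e)) = (e g a) b (1 - e) is checked after multiplying by [c m]. *)
have efr a b : R e g a = a -> R e g (fr a b) = fr a b.
  move=> ea; apply/eqP; rewrite -subr_eq0; apply/eqP/rfaithful => c m.
  by rewrite gmulBl gmulA !frA -gmulA ea subrr.
have ee z : R e g (R e g z) = R e g z by rewrite -gmulA egee.
move=> corner.
(* Multiplying the corner by [b m] and then by 1 - e turns it into F of two elements of e M (1 -
   e). *)
have Fe : R (R e g (F x y)) g e = 0.
  apply: corner => b m c; rewrite hFl !hFr fr_compat.
  by apply: F_peirce12; rewrite ?fr_mul_idem // efr // !gmulA ee.
have : fr (R e g (F x y)) g = 0.
  rewrite hFl fr_compat.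
  by apply: F_peirce12; rewrite ?fr_mul_idem // efr.
by rewrite frg Fe subr0.
Qed.

End Peirce.

End GammaRing.

Theorem theorem3p1 (k : nat) (hk : (0 < k)%N)
  (M G : zmodType) (R : gammaRing M G)
  (Lam : Type) (e : Lam -> M) (g : Lam -> G)
  (he : forall al, gidempotent R (g al) (e al))
  (fl : Lam -> G -> M -> M) (fr : Lam -> M -> G -> M)
  (h1 : forall al, formal_complement R (g al) (e al) (fl al) (fr al))
  (h2 : forall x : M, gset_mul R [set x] setT setT = [set 0] -> x = 0)
  (h3 : forall x : M,
     (forall al,
        gset_mul R (gset_mul R [set e al] setT setT) setT [set x] = [set 0]) ->
     x = 0)
  (h4 : forall (al : Lam) (x : M),
     (forall (b : G) (m : M) (c : G),
        fr al (R (R (R (e al) (g al) x) (g al) (e al)) b m) c = 0) ->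
     R (R (e al) (g al) x) (g al) (e al) = 0)
  (f : M -> G -> M -> M)
  (h5 : forall (x : M) (c : G), f x c 0 = 0 /\ f 0 c x = 0)
  (h6 : forall (s : k.-tuple (M * G)) (x y : M) (c : G),
     lword R s (f x c y) = f (lword R s x) c (lword R s y))
  (h7 : forall (s : k.-tuple (G * M)) (x y : M) (c : G),
     rword R (f x c y) s = f (rword R x s) c (rword R y s)) :
  forall (x : M) (c : G) (y : M), f x c y = 0.
Proof.
have rfaithful x : (forall b m, R x b m = 0) -> x = 0.
  move=> H; apply: h2; apply: gset_mul_eq0 => a t b /= -> _ _; exact: H.
have efaithful x : (forall al b m c, R (R (e al) b m) c x = 0) -> x = 0.
  move=> H; apply: h3 => al; apply: gset_mul_eq0 => a t b [s sP ->] _ /= ->.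
  (* The left factor [a] is a finite sum of products of [e al], so additivity reduces to single
     products. *)
  have additive : {morph (fun z => R z t x) : u v / u + v}.
    by move=> u v; rewrite gmulDl.
  rewrite (big_morph _ additive (gmul0l R t x)) big_seq big1 // => p.
  by move=> /sP [/= -> _ _]; apply: H.
have lfaithful x : (forall m b, R m b x = 0) -> x = 0.
  by move=> H; apply: efaithful => *; apply: H.
move=> x c y.
pose F u v := f u c v.
have F0r z : F z 0 = 0 by case: (h5 z c).
have F0l z : F 0 z = 0 by case: (h5 z c).
have hFl : forall x y u b, R u b (F x y) = F (R u b x) (R u b y).
  by apply: (lword_compat1 lfaithful hk) => s ? ?; apply: h6.
have hFr : forall x y b u, R (F x y) b u = F (R x b u) (R y b u).
  by apply: (rword_compat1 rfaithful hk) => s ? ?; apply: h7.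
apply: efaithful => al b m d.
have [_ ee] := he al.
(* Writing e = e g e frees a leading factor e g; the remaining left factors are absorbed into the
   arguments of [F]. *)
rewrite -ee !gmulA -/(F x y) (hFl x) (hFl _ _ (e al) b).
exact: (F_corner rfaithful F0r F0l hFl hFr ee (h1 al) _ _ (h4 al)).
Qed.
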